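(* Let $\mathbb{F}$ be a field, $\Gamma$ a group, $N\lhd\Gamma$ a normal subgroup and $G=\Gamma/N$. Let $c\in Z^2(\Gamma,\mathbb{F}^* )$ and $\alpha\in Z^2(G,\mathbb{F}^* )$. Then $$\alpha(\mathbb{F}^c\Gamma)\stackrel{G}{\cong}\mathbb{F}^{c\cdot\inf^G_{\Gamma}(\alpha)}\Gamma.$$
   Context: Cocycles are with respect to the trivial action on $\mathbb{F}^*$. $\mathbb{F}^c\Gamma=\bigoplus_{\gamma\in\Gamma}\mathbb{F}u_\gamma$ with $u_{\gamma_1}u_{\gamma_2}=c(\gamma_1,\gamma_2)u_{\gamma_1\gamma_2}$ is the twisted group algebra; with $\pi:\Gamma\to G$ the quotient map, twisted group algebras of $\Gamma$ are $G$-graded with $g$-component spanned by the $u_\gamma$ with $\pi(\gamma)=g$. $\mathbb{F}^{\alpha}G$ is $G$-graded with components $\mathbb{F}v_g$, $v_gv_h=\alpha(g,h)v_{gh}$. For a $G$-graded algebra $A_G=\bigoplus_gA_g$, its twisting by $\alpha$ is the $G$-graded algebra $\alpha(A_G):=\mathbb{F}^{\alpha}G\otimes^G_{\mathbb{F}}A_G=\bigoplus_g\mathbb{F}v_g\otimes_{\mathbb{F}}A_g\subseteq\mathbb{F}^{\alpha}G\otimes_{\mathbb{F}}A_G$. The inflation is $\inf^G_{\Gamma}(\alpha)(\gamma_1,\gamma_2):=\alpha(\pi(\gamma_1),\pi(\gamma_2))$. $\stackrel{G}{\cong}$ denotes a degree-preserving algebra isomorphism. *)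

(* Defs.v *)
From HB Require Import structures.
From mathcomp Require Import all_boot all_algebra.
From mathcomp Require Import finmap boolp classical_sets.
From mathcomp Require Import monalg.

Set Implicit Arguments.
Unset Strict Implicit.
Unset Printing Implicit Defensive.

Import GRing.Theory.

Local Open Scope ring_scope.
Local Open Scope quotient_scope.

Section Span.
Variables (F : fieldType) (V : lmodType F).
Implicit Type S : V -> Prop.

(* The linear span of S. *)
Definition lspan S : {pred V} := fun x =>
  `[< exists2 s : seq (F * V), {in s, forall p, S p.2}
                             & x = \sum_(p <- s) p.1 *: p.2 >].

Lemma lspan_closed S : GRing.submod_closed (lspan S).
Proof.
split=> [|a x y /asboolP[s Ss ->] /asboolP[t St ->]]; apply/asboolP.
  by exists [::]; rewrite ?big_nil.
exists ([seq (a * p.1, p.2) | p <- s] ++ t).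
  by move=> p; rewrite mem_cat => /orP[|/St//]; case/mapP=> q sq ->; exact: (Ss q).
rewrite big_cat big_map scaler_sumr /=; congr (_ + _).
by apply: eq_bigr => p _; rewrite scalerA.
Qed.
HB.instance Definition _ S := GRing.isSubmodClosed.Build F V (lspan S)
  (lspan_closed S).

Lemma mem_lspan S x : S x -> x \in lspan S.
Proof.
move=> Sx; apply/asboolP; exists [:: (1, x)].
  by move=> p; rewrite inE => /eqP ->.
by rewrite big_seq1 scale1r.
Qed.

Lemma lspan_ind S (P : V -> Prop) :
    P 0 -> (forall a x y, P x -> P y -> P (a *: x + y)) ->
    (forall x, S x -> P x) ->
  forall x, x \in lspan S -> P x.
Proof.
move=> P0 PD PS x /asboolP[s Ss ->].
elim: s Ss => [|p s IH] Ss; first by rewrite big_nil.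
rewrite big_cons; apply: PD; first by apply/PS/Ss; rewrite mem_head.
by apply: IH => q sq; apply: Ss; rewrite inE sq orbT.
Qed.

End Span.

(* Linear extension to the free vector space {malg F[K]} of a function
   defined on its basis K. *)
HB.lock Definition malg_ext (F : fieldType) (K : choiceType) (V : lmodType F)
  (f : K -> V) (x : {malg F[K]}) : V := \sum_(k <- msupp x) x@_k *: f k.

Section LinearExtension.
Variables (F : fieldType) (K : choiceType) (V : lmodType F).
Implicit Types (f : K -> V) (x y : {malg F[K]}).

Lemma malg_extEw f x (d : {fset K}) : (msupp x `<=` d)%fset ->
  malg_ext f x = \sum_(k <- d) x@_k *: f k.
Proof.
rewrite malg_ext.unlock => le_xd; apply: big_fset_incl => // k _.
by move/mcoeff_outdom->; rewrite scale0r.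
Qed.

Lemma malg_ext_linear f : linear (malg_ext f).
Proof.
move=> a x y; pose d := (msupp x `|` msupp y `|` msupp (a *: x + y))%fset.
rewrite !(@malg_extEw _ _ d); try by apply/fsubsetP=> k kx; rewrite !inE kx ?orbT.
rewrite scaler_sumr -big_split; apply: eq_bigr => k _ /=.
by rewrite mcoeffD mcoeffZ scalerDl scalerA.
Qed.
HB.instance Definition _ f :=
  GRing.isLinear.Build F {malg F[K]} V _ (malg_ext f) (malg_ext_linear f).

Lemma malg_extU f k a : malg_ext f (mkmalgU k a) = a *: f k.
Proof. by rewrite (malg_extEw _ msuppU_le) big_seq_fset1 mcoeffUU. Qed.

Lemma malg_linE (g : {malg F[K]} -> V) : linear g ->
  forall x, g x = malg_ext (fun k => g (mkmalgU k 1)) x.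
Proof.
move=> glin x.
have g0 : g 0 = 0.
  by have := glin (-1) 0 0; rewrite !scaleN1r oppr0 addr0 addNr.
have gZ a y : g (a *: y) = a *: g y by rewrite -[a *: y]addr0 glin g0 addr0.
have gD y z : g (y + z) = g y + g z by rewrite -{1}[y]scale1r glin scale1r.
rewrite malg_ext.unlock {1}[x]monalgE (big_morph g gD g0); apply: eq_bigr => k _.
rewrite -gZ; congr g; apply/malgP => k'.
by rewrite mcoeffZ !mcoeffU mulrnAr mulr1.
Qed.

Lemma malg_ext_eq f g : f =1 g -> malg_ext f =1 malg_ext g.
Proof.
by move=> fg x; rewrite malg_ext.unlock; apply: eq_bigr => k _; rewrite fg.
Qed.

Lemma malg_extP f g a x :
  malg_ext (fun k => a *: f k + g k) x = a *: malg_ext f x + malg_ext g x.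
Proof.
rewrite malg_ext.unlock scaler_sumr -big_split; apply: eq_bigr => k _ /=.
by rewrite scalerDr !scalerA mulrC.
Qed.

End LinearExtension.

Lemma malg_lin_eq (F : fieldType) (K : choiceType) (V : lmodType F)
    (g h : {malg F[K]} -> V) : linear g -> linear h ->
  (forall k, g (mkmalgU k 1) = h (mkmalgU k 1)) -> g =1 h.
Proof.
move=> gl hl gh x; rewrite (malg_linE gl) (malg_linE hl).
exact: malg_ext_eq.
Qed.

Definition bilin (F : fieldType) (V W U : lmodType F) (f : V -> W -> U) :=
  (forall w, linear (f^~ w)) /\ (forall v, linear (f v)).

(* The tensor product over F of two vector spaces: the free vector space on
   V * W modulo the subspace spanned by the bilinearity relations. *)
Section TensorCarrier.
Variables (F : fieldType) (V W : lmodType F).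

Local Notation free := {malg F[(V * W)%type]}.
Local Notation "[ v ; w ]" := (mkmalgU (v, w) 1 : free).

Definition tensor_relation (x : free) : Prop :=
  (exists a v v' w, x = [a *: v + v'; w] - (a *: [v; w] + [v'; w])) \/
  (exists a v w w', x = [v; a *: w + w'] - (a *: [v; w] + [v; w'])).

Definition tensor_ker : {pred free} := lspan tensor_relation.
HB.instance Definition _ := GRing.SubmodClosed.on tensor_ker.

Definition tensor := Quotient.quot tensor_ker.
HB.instance Definition _ := GRing.Zmodule.on tensor.
HB.instance Definition _ := Quotient.on tensor.

End TensorCarrier.

(* These operations are locked so that comparing two elements does not unfold
   them down to finite maps. *)
HB.lock Definition tensor_scale (F : fieldType) (V W : lmodType F)
  (a : F) (x : tensor V W) : tensor V W := \pi_(tensor V W) (a *: repr x).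

HB.lock Definition tens (F : fieldType) (V W : lmodType F)
  (v : V) (w : W) : tensor V W := \pi_(tensor V W) (mkmalgU (v, w) 1).

(* The linear map v (x) w |-> f v w, when f is bilinear. *)
HB.lock Definition tensor_lift (F : fieldType) (V W U : lmodType F)
  (f : V -> W -> U) (x : tensor V W) : U :=
  malg_ext (fun p => f p.1 p.2) (repr x).

Section Tensor.
Variables (F : fieldType) (V W : lmodType F).
Local Notation free := {malg F[(V * W)%type]}.
Local Notation tensor := (tensor V W).
Local Notation tensor_ker := (@tensor_ker F V W).
Local Notation tensor_scale := (@tensor_scale F V W).
Local Notation tens := (@tens F V W).

Lemma tensor_piP (x y : free) :
  (\pi_tensor x = \pi_tensor y) <-> (x - y \in tensor_ker).
Proof. by rewrite Quotient.idealrBE; split=> [->|/eqP ->]. Qed.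

Lemma tensor_piD (x y : free) :
  \pi_tensor (x + y) = \pi_tensor x + \pi_tensor y.
Proof. by rewrite (Quotient.pi_add tensor_ker). Qed.

Lemma tensor_pi_scale a (x : free) :
  \pi_tensor (a *: x) = tensor_scale a (\pi_tensor x).
Proof.
rewrite tensor_scale.unlock; apply/tensor_piP; rewrite -scalerBr; apply: rpredZ.
by apply/tensor_piP; rewrite reprK.
Qed.

Fact tensor_scaleA a b x :
  tensor_scale a (tensor_scale b x) = tensor_scale (a * b) x.
Proof.
rewrite -[x]reprK -(tensor_pi_scale b) -(tensor_pi_scale a).
by rewrite -(tensor_pi_scale (a * b)) scalerA.
Qed.
Fact tensor_scale1 : left_id 1 tensor_scale.
Proof. by move=> x; rewrite -[x]reprK -tensor_pi_scale scale1r. Qed.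
Fact tensor_scaleDr : right_distributive tensor_scale +%R.
Proof.
move=> a x y; rewrite -[x]reprK -[y]reprK -tensor_piD.
by rewrite -!(tensor_pi_scale a) scalerDr tensor_piD.
Qed.
Fact tensor_scaleDl x : {morph tensor_scale^~ x : a b / a + b}.
Proof.
move=> a b /=; rewrite -[x]reprK -(tensor_pi_scale a) -(tensor_pi_scale b).
by rewrite -(tensor_pi_scale (a + b)) scalerDl tensor_piD.
Qed.
HB.instance Definition _ := GRing.Zmodule_isLmodule.Build F tensor
  tensor_scaleA tensor_scale1 tensor_scaleDr tensor_scaleDl.

Lemma tensor_pi_linear : linear (\pi_tensor : free -> tensor).
Proof. by move=> a x y; rewrite tensor_piD tensor_pi_scale. Qed.

Lemma tens_bilin : bilin tens.
Proof.
split=> u a x y; rewrite tens.unlock -tensor_pi_linear; apply/tensor_piP/mem_lspan.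
  by left; exists a, x, y, u.
by right; exists a, u, x, y.
Qed.

Lemma tensDl a v v' w : tens (a *: v + v') w = a *: tens v w + tens v' w.
Proof. exact: tens_bilin.1. Qed.
Lemma tensDr a v w w' : tens v (a *: w + w') = a *: tens v w + tens v w'.
Proof. exact: tens_bilin.2. Qed.

Lemma tens_ind (P : tensor -> Prop) :
    P 0 -> (forall a x y, P x -> P y -> P (a *: x + y)) ->
    (forall v w, P (tens v w)) -> forall x, P x.
Proof.
move=> P0 PD Pt x; rewrite -[x]reprK.
rewrite (malg_linE tensor_pi_linear) malg_ext.unlock.
apply: big_ind => // [y z Py Pz|[v w] _].
  by rewrite -[y]scale1r; apply: PD.
by rewrite -[X in P X]addr0; apply: PD => //; have := Pt v w; rewrite tens.unlock.
Qed.

Section Lift.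
Variables (U : lmodType F) (f : V -> W -> U).
Hypothesis fbil : bilin f.

Lemma tensor_lift_pi (x : free) :
  tensor_lift f (\pi_tensor x) = malg_ext (fun p => f p.1 p.2) x.
Proof.
apply/eqP; rewrite tensor_lift.unlock -subr_eq0 -raddfB /=; apply/eqP.
have: repr (\pi_tensor x) - x \in tensor_ker.
  by apply/tensor_piP; rewrite reprK.
move: (_ - x); apply: lspan_ind => [|a y z hy hz|y]; first exact: raddf0.
  by rewrite malg_ext_linear hy hz scaler0 addr0.
by case=> [] [a] [v] [v'] [w] ->;
  rewrite raddfB /= malg_ext_linear !malg_extU !scale1r /= (fbil.1, fbil.2) subrr.
Qed.

Lemma tensor_lift_linear : linear (tensor_lift f).
Proof.
move=> a x y; rewrite -[x]reprK -[y]reprK -tensor_pi_linear !tensor_lift_pi.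
exact: malg_ext_linear.
Qed.

Lemma tensor_lift_tens v w : tensor_lift f (tens v w) = f v w.
Proof. by rewrite tens.unlock tensor_lift_pi malg_extU scale1r. Qed.

End Lift.

Lemma tensor_liftP (U : lmodType F) (f g : V -> W -> U) a x :
  tensor_lift (fun v w => a *: f v w + g v w) x =
  a *: tensor_lift f x + tensor_lift g x.
Proof. by rewrite tensor_lift.unlock; exact: malg_extP. Qed.

Lemma tensor_lift_eq (U : lmodType F) (f g : V -> W -> U) :
  f =2 g -> tensor_lift f =1 tensor_lift g.
Proof.
by move=> fg x; rewrite tensor_lift.unlock; apply: malg_ext_eq => p; apply: fg.
Qed.

Lemma tensor_lin_eq (U : lmodType F) (f g : tensor -> U) :
    linear f -> linear g -> (forall v w, f (tens v w) = g (tens v w)) ->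
  f =1 g.
Proof.
move=> fl gl fg.
have lin0 (h : tensor -> U) : linear h -> h 0 = 0.
  move=> hl; have := hl (-1) 0 0.
  by rewrite !scaleN1r oppr0 addr0 addNr.
apply: tens_ind => [|a x y hx hy|v w]; last exact: fg.
  by rewrite !lin0.
by rewrite fl gl hx hy.
Qed.

End Tensor.

(* Over a field every nonzero vector is mapped to 1 by some linear form. *)
Lemma linear_form_exists (F : fieldType) (V : lmodType F) (v : V) : v != 0 ->
  exists2 phi : V -> F, scalar phi & phi v = 1.
Proof.
move=> v0; pose P (A : set V) :=
  (forall a x y, A x -> A y -> A (a *: x + y)) /\ ~ A v.
have [C CP Ctot|A [[AD Av] Amax]] := @Zorn_bigcup V P.
  split=> [a x y [X CX Xx] [Y CY Yy]|[X CX Xv]]; last exact: (CP X CX).2.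
  have [XY|YX] := Ctot X Y CX CY.
    by exists Y => //; apply: (CP Y CY).1 => //; apply: XY.
  by exists X => //; apply: (CP X CX).1 => //; apply: YX.
have A0 : A 0.
  apply: contrapT => nA0; have nA x : ~ A x.
    by move=> Ax; apply: nA0; rewrite -(addNr x) -scaleN1r; apply: AD.
  apply: (Amax [set 0]%classic); first by split=> [x /nA//|/(_ 0 erefl)/nA].
  split=> [a x y /= -> ->|/= /eqP]; first by rewrite scaler0 addr0.
  by rewrite (negPf v0).
have AZ a x : A x -> A (a *: x) by move=> Ax; rewrite -[_ *: _]addr0; apply: AD.
have dec x : exists a, A (x - a *: v).
  have [Ax|nAx] := pselect (A x); first by exists 0; rewrite scale0r subr0.
  pose B y := exists b, A (y - b *: x).
  have nPB : ~ P B.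
    apply: Amax; split=> [y Ay|/(_ x)]; first by exists 0; rewrite scale0r subr0.
    by move=> H; apply/nAx/H; exists 1; rewrite scale1r subrr.
  have [b Ab] : B v.
    apply: contrapT => nBv; apply: nPB; split=> // a y z [b Ab] [b' Ab'].
    exists (a * b + b'); have := AD a _ _ Ab Ab'.
    by rewrite scalerBr scalerA addrACA -opprD -scalerDl.
  have b0 : b != 0.
    by apply: contra_notN Av => /eqP b0; move: Ab; rewrite b0 scale0r subr0.
  exists b^-1; have := AZ (- b^-1) _ Ab.
  by rewrite scalerBr !scaleNr opprK scalerA mulVf // scale1r addrC.
have uni x a b : A (x - a *: v) -> A (x - b *: v) -> a = b.
  move=> Ha Hb; apply: contrapT => /eqP ab; apply: Av.
  have ba : b - a != 0 by rewrite subr_eq0 eq_sym.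
  have := AD (-1) _ _ Hb Ha.
  rewrite scaleN1r opprB -addrA addKr -scalerBl.
  by move/(AZ (b - a)^-1); rewrite scalerA mulVf // scale1r.
pose phi x := sval (cid (dec x)).
have phiP x : A (x - phi x *: v) by rewrite /phi; case: cid.
exists phi => [a x y|]; last by apply: (uni v); rewrite // scale1r subrr.
apply: (uni (a *: x + y)) => //; have := AD a _ _ (phiP x) (phiP y).
by rewrite scalerBr scalerA addrACA -opprD -scalerDl.
Qed.

Definition tensor_alg (F : fieldType) (A B : algType F) := tensor A B.
HB.instance Definition _ (F : fieldType) (A B : algType F) :=
  GRing.Lmodule.on (tensor_alg A B).

(* The product determined by (a (x) b) (a' (x) b') = a a' (x) b b'. *)
HB.lock Definition tensor_mul (F : fieldType) (A B : algType F)
  (x y : tensor_alg A B) : tensor_alg A B :=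
  tensor_lift (fun a b =>
    tensor_lift (fun a' b' => tens (a * a') (b * b')) y) x.

Section TensorAlgebra.
Variables (F : fieldType) (A B : algType F).
Local Notation tensor_alg := (tensor_alg A B).
Local Notation tensor_mul := (@tensor_mul F A B).
Implicit Types x y z : tensor_alg.

Definition tensor_one : tensor_alg := tens 1 1.

Fact tensor_mul_bilin1 (a : A) (b : B) :
  bilin (fun a' b' => tens (a * a') (b * b')).
Proof.
by split=> ? ? ? ?; rewrite mulrDr -scalerAr (tensDl, tensDr).
Qed.

Fact tensor_mul_bilin2 y : bilin (fun (a : A) (b : B) =>
  tensor_lift (fun a' b' => tens (a * a') (b * b')) y).
Proof.
by split=> u k v w; rewrite -tensor_liftP; apply: tensor_lift_eq => a' b';
  rewrite mulrDl -scalerAl (tensDl, tensDr).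
Qed.

Fact tensor_mulDl k x y z :
  tensor_mul (k *: x + y) z = k *: tensor_mul x z + tensor_mul y z.
Proof. by rewrite tensor_mul.unlock (tensor_lift_linear (tensor_mul_bilin2 z)). Qed.

Fact tensor_mulDr k x y z :
  tensor_mul z (k *: x + y) = k *: tensor_mul z x + tensor_mul z y.
Proof.
rewrite tensor_mul.unlock -tensor_liftP; apply: tensor_lift_eq => a b.
exact: (tensor_lift_linear (tensor_mul_bilin1 a b)).
Qed.

Lemma tensor_mul_tens (a a' : A) (b b' : B) :
  tensor_mul (tens a b) (tens a' b') = tens (a * a') (b * b').
Proof.
rewrite tensor_mul.unlock (tensor_lift_tens (tensor_mul_bilin2 _)).
by rewrite (tensor_lift_tens (tensor_mul_bilin1 _ _)).
Qed.

Fact tensor_mulA : associative tensor_mul.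
Proof.
move=> x y z; move: x; apply: tensor_lin_eq.
- by move=> k u v; rewrite tensor_mulDl.
- by move=> k u v; rewrite !tensor_mulDl.
move=> a b; move: y; apply: tensor_lin_eq.
- by move=> k u v; rewrite tensor_mulDl tensor_mulDr.
- by move=> k u v; rewrite tensor_mulDr tensor_mulDl.
move=> a' b'; move: z; apply: tensor_lin_eq.
- by move=> k u v; rewrite !tensor_mulDr.
- by move=> k u v; rewrite tensor_mulDr.
by move=> a'' b''; rewrite !tensor_mul_tens !mulrA.
Qed.

Fact tensor_mul1 : left_id tensor_one tensor_mul.
Proof.
apply: tensor_lin_eq => [k x y|//|a b]; first exact: tensor_mulDr.
by rewrite tensor_mul_tens !mul1r.
Qed.

Fact tensor_mulr1 : right_id tensor_one tensor_mul.
Proof.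
apply: tensor_lin_eq => [k x y|//|a b]; first exact: tensor_mulDl.
by rewrite tensor_mul_tens !mulr1.
Qed.

Fact tensor_mul_addl : left_distributive tensor_mul +%R.
Proof. by move=> x y z; have := tensor_mulDl 1 x y z; rewrite !scale1r. Qed.

Fact tensor_mul_addr : right_distributive tensor_mul +%R.
Proof. by move=> x y z; have := tensor_mulDr 1 y z x; rewrite !scale1r. Qed.

Fact tensor_oner_neq0 : tensor_one != 0.
Proof.
have [phi phil phi1] := linear_form_exists (oner_neq0 A).
have fbil : bilin (fun (a : A) (b : B) => phi a *: b).
  split=> [b k a a'|a k b b']; first by rewrite phil scalerDl scalerA.
  by rewrite scalerDr !scalerA mulrC.
apply/eqP=> /(congr1 (tensor_lift (fun a (b : B) => phi a *: b))).
rewrite (tensor_lift_tens fbil) phi1 scale1r => /eqP.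
have := tensor_lift_linear fbil (-1) 0 0.
by rewrite !scaleN1r oppr0 addr0 addNr => ->; rewrite oner_eq0.
Qed.

HB.instance Definition _ := GRing.Zmodule_isNzRing.Build tensor_alg
  tensor_mulA tensor_mul1 tensor_mulr1 tensor_mul_addl tensor_mul_addr
  tensor_oner_neq0.

Fact tensor_scalerAl k x y : k *: (x * y) = k *: x * y.
Proof.
have /(_ y) mul0 : left_zero (0 : tensor_alg) *%R by exact: mul0r.
by have := tensor_mulDl k x 0 y; rewrite addr0 [tensor_mul 0 y]mul0 addr0.
Qed.
HB.instance Definition _ := GRing.Lmodule_isLalgebra.Build F tensor_alg
  tensor_scalerAl.

Fact tensor_scalerAr k x y : k *: (x * y) = x * (k *: y).
Proof.
have /(_ x) mul0 : right_zero (0 : tensor_alg) *%R by exact: mulr0.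
by have := tensor_mulDr k y 0 x; rewrite addr0 [tensor_mul x 0]mul0 addr0.
Qed.
HB.instance Definition _ := GRing.Lalgebra_isAlgebra.Build F tensor_alg
  tensor_scalerAr.

Lemma tensM (a a' : A) (b b' : B) :
  (tens a b : tensor_alg) * tens a' b' = tens (a * a') (b * b').
Proof. exact: tensor_mul_tens. Qed.

End TensorAlgebra.

(* A subgroup is given by its characteristic function; since boolp decides
   every proposition, this is no restriction on the subgroup. *)
HB.mixin Record isConjgClosed (G : groupType) (S : {pred G}) := {
  gpred_conj : forall x y, x \in S -> (x ^ y)%g \in S
}.

#[short(type="normalSubgroup")]
HB.structure Definition NormalSubgroup (G : groupType) :=
  {S of GroupClosed G S & isConjgClosed G S}.

Section QuotientGroup.
Variables (Gamma : groupType) (N : normalSubgroup Gamma).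
Implicit Types x y : Gamma.
Local Open Scope group_scope.

Definition coset_eq x y := x^-1 * y \in N.

Fact coset_eq_equiv : equiv_class_of coset_eq.
Proof.
rewrite /coset_eq; split=> [x|x y|y x z Nxy Nyz].
- by rewrite mulVg gpred1.
- by rewrite -(gpredV N) invgM invgK.
by have := gpredM _ _ Nxy Nyz; rewrite mulgA mulgK.
Qed.
Canonical coset_eq_rel := EquivRelPack coset_eq_equiv.
Canonical coset_eq_enc := defaultEncModRel coset_eq.

Definition quotient_group := {eq_quot coset_eq}.
HB.instance Definition _ : EqQuotient Gamma coset_eq quotient_group :=
  EqQuotient.on quotient_group.
HB.instance Definition _ := Choice.on quotient_group.

Definition quotient_one : quotient_group := \pi_quotient_group 1.
Definition quotient_mul (u v : quotient_group) : quotient_group :=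
  \pi_quotient_group (repr u * repr v).
Definition quotient_inv (u : quotient_group) : quotient_group :=
  \pi_quotient_group (repr u)^-1.

Lemma quotient_piP x y : (\pi_quotient_group x = \pi_quotient_group y) <-> (x^-1 * y \in N).
Proof. by split=> [/eqP|?]; [|apply/eqP]; rewrite piE. Qed.

Lemma quotient_piM x y :
  \pi_quotient_group (x * y) = quotient_mul (\pi_quotient_group x) (\pi_quotient_group y).
Proof.
rewrite /quotient_mul; case: piP => x' /quotient_piP Nx.
case: piP => y' /quotient_piP Ny; apply/quotient_piP.
have := gpredM _ _ (gpred_conj _ y Nx) Ny.
by rewrite /conjg invgM !mulgA mulgK.
Qed.

Lemma quotient_piV x : \pi_quotient_group x^-1 = quotient_inv (\pi_quotient_group x).
Proof.
rewrite /quotient_inv; case: piP => x' /quotient_piP Nx; apply/quotient_piP.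
have := gpred_conj _ x^-1 Nx; rewrite -(gpredV N).
by rewrite /conjg !invgM !invgK !mulgA mulgK.
Qed.

Fact quotient_mulA : associative quotient_mul.
Proof.
move=> u v w; rewrite -[u]reprK -[v]reprK -[w]reprK.
rewrite -(quotient_piM (repr v)) -(quotient_piM (repr u) (repr v)).
by rewrite -(quotient_piM (repr u)) -quotient_piM mulgA.
Qed.
Fact quotient_mul1 : left_id quotient_one quotient_mul.
Proof. by move=> u; rewrite -[u]reprK -quotient_piM mul1g. Qed.
Fact quotient_mulr1 : right_id quotient_one quotient_mul.
Proof. by move=> u; rewrite -[u]reprK -quotient_piM mulg1. Qed.
Fact quotient_mulV : left_inverse quotient_one quotient_inv quotient_mul.
Proof.
by move=> u; rewrite -[u]reprK -quotient_piV -quotient_piM mulVg.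
Qed.
Fact quotient_mulrV : right_inverse quotient_one quotient_inv quotient_mul.
Proof.
by move=> u; rewrite -[u]reprK -quotient_piV -quotient_piM mulgV.
Qed.
HB.instance Definition _ := isGroup.Build quotient_group quotient_mulA
  quotient_mul1 quotient_mulr1 quotient_mulV quotient_mulrV.

Definition quotient_map (x : Gamma) : quotient_group := \pi_quotient_group x.
HB.instance Definition _ :=
  monoid.isMultiplicative.Build Gamma quotient_group quotient_map quotient_piM.

End QuotientGroup.

(* Z^2(Gamma, F^* ) for the trivial action. *)
Record cocycle2 (F : fieldType) (Gamma : groupType) := Cocycle2 {
  coc_val :> Gamma -> Gamma -> F;
  coc_neq0 : forall x y, coc_val x y != 0;
  cocP : forall x y z,
    coc_val x y * coc_val (x * y)%g z = coc_val y z * coc_val x (y * z)%g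
}.

Section Cocycles.
Variables (F : fieldType) (Gamma G : groupType).

Section Mul.
Variables c d : cocycle2 F Gamma.
Fact coc_mul_neq0 x y : c x y * d x y != 0.
Proof. by rewrite mulf_neq0 ?coc_neq0. Qed.
Fact coc_mulP x y z : (c x y * d x y) * (c (x * y)%g z * d (x * y)%g z) =
  (c y z * d y z) * (c x (y * z)%g * d x (y * z)%g).
Proof. by rewrite mulrACA !cocP mulrACA. Qed.
Definition coc_mul := Cocycle2 coc_mul_neq0 coc_mulP.
End Mul.

Section Inflation.
Variables (p : {multiplicative Gamma -> G}) (alpha : cocycle2 F G).
Fact inflation_neq0 x y : alpha (p x) (p y) != 0.
Proof. exact: coc_neq0. Qed.
Fact inflationP x y z :
  alpha (p x) (p y) * alpha (p (x * y)%g) (p z) =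
  alpha (p y) (p z) * alpha (p x) (p (y * z)%g).
Proof. by rewrite !gmulfM cocP. Qed.
Definition inflation := Cocycle2 inflation_neq0 inflationP.
End Inflation.

Lemma coc1l (c : cocycle2 F Gamma) x : c 1%g x = c 1%g 1%g.
Proof. by have := cocP c 1%g 1%g x; rewrite !mul1g => /mulIf->//; apply: coc_neq0. Qed.
Lemma coc1r (c : cocycle2 F Gamma) x : c x 1%g = c 1%g 1%g.
Proof. by have := cocP c x 1%g 1%g; rewrite !mulg1 => /mulIf->//; apply: coc_neq0. Qed.

End Cocycles.

(* f : {malg A[G]} is a finitely supported family of elements of A indexed
   by G, so gr_direct says that A is the internal direct sum of the A_g. *)
Record gradedAlgebra (F : fieldType) (G : groupType) := GradedAlgebra {
  gr_alg :> algType F;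
  gr_comp : G -> {pred gr_alg};
  gr_submod : forall g, GRing.submod_closed (gr_comp g);
  gr_one : 1 \in gr_comp 1%g;
  gr_mul : forall g h x y,
    x \in gr_comp g -> y \in gr_comp h -> x * y \in gr_comp (g * h)%g;
  gr_direct : forall x : gr_alg, exists! f : {malg gr_alg[G]},
    (forall g, f@_g \in gr_comp g) /\ x = \sum_(g <- msupp f) f@_g
}.

Arguments gr_comp {F G} A g : rename.
Arguments gr_submod {F G} A g : rename.
Arguments gr_direct {F G} A x : rename.

Definition graded_iso (F : fieldType) (G : groupType)
    (A B : gradedAlgebra F G) : Prop :=
  exists f : {lrmorphism A -> B},
    bijective f /\
    (forall g x, (f x \in gr_comp B g) = (x \in gr_comp A g)).

Section DirectSum.
Variables (F : fieldType) (V U : lmodType F) (G : choiceType).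
Variables (C : G -> {pred V}) (p : G -> V -> U).

Lemma malg_sumEw (f : {malg V[G]}) (d : {fset G}) : (msupp f `<=` d)%fset ->
  \sum_(g <- msupp f) f@_g = \sum_(g <- d) f@_g.
Proof. by move=> le_fd; apply: big_fset_incl => // g _ /mcoeff_outdom. Qed.

Hypothesis C_closed : forall g, GRing.submod_closed (C g).
Hypothesis p_linear : forall g, linear (p g).
Hypothesis p_orth : forall g h x, x \in C h -> h != g -> p g x = 0.
Hypothesis p_inj : forall g x, x \in C g -> p g x = 0 -> x = 0.
Hypothesis C_span : forall x, x \in lspan (fun y => exists g, y \in C g).

Lemma direct_sum_criterion x : exists! f : {malg V[G]},
  (forall g, f@_g \in C g) /\ x = \sum_(g <- msupp f) f@_g.
Proof.
have C0 g : 0 \in C g by case: (C_closed g).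
have CD g a u v : u \in C g -> v \in C g -> a *: u + v \in C g.
  by case: (C_closed g) => _ + Cu Cv; apply.
have p0 g : p g 0 = 0.
  by have := p_linear g (-1) 0 0; rewrite !scaleN1r oppr0 addr0 addNr.
have pD g u v : p g (u + v) = p g u + p g v.
  by rewrite -{1}[u]scale1r p_linear scale1r.
have pE (f : {malg V[G]}) g : (forall g, f@_g \in C g) ->
    p g (\sum_(h <- msupp f) f@_h) = p g f@_g.
  move=> fC; rewrite (@malg_sumEw _ (msupp f `|` [fset g])%fset) ?fsubsetUl //.
  rewrite (big_morph (p g) (pD g) (p0 g)) (big_fsetD1 g) ?inE ?eqxx ?orbT //=.
  rewrite big1_fset ?addr0 // => h; rewrite !inE => /andP[hg _] _.
  exact: (p_orth (fC h)).
have [f [fC xE]] : exists f : {malg V[G]},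
    (forall g, f@_g \in C g) /\ x = \sum_(g <- msupp f) f@_g.
  move: x (C_span x); apply: lspan_ind => [|a x y [f [fC ->]] [f' [f'C ->]]|x].
  - exists 0; split=> [g|]; first by rewrite mcoeff0.
    by rewrite msupp0 big_seq_fset0.
  - pose d := (msupp f `|` msupp f')%fset.
    pose f2 : {malg V[G]} := [malg g in d => a *: f@_g + f'@_g].
    have f2E g : f2@_g = a *: f@_g + f'@_g.
      rewrite mcoeffE; case: ifP => //; rewrite inE => /norP[nf nf'].
      by rewrite !mcoeff_outdom // scaler0 addr0.
    exists f2; split=> [g|]; first by rewrite f2E CD.
    have le2 : (msupp f2 `<=` d)%fset.
      apply/fsubsetP=> g; rewrite -mcoeff_neq0; apply: contraNT => nd.
      by rewrite mcoeffE (negPf nd).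
    rewrite (malg_sumEw le2) (malg_sumEw (fsubsetUl _ _ : _ `<=` d)%fset).
    rewrite (malg_sumEw (fsubsetUr _ _ : _ `<=` d)%fset).
    by rewrite scaler_sumr -big_split; apply: eq_bigr => g _; rewrite f2E.
  case=> g Cx; exists (mkmalgU g x); split=> [h|].
    by rewrite mcoeffU; case: eqP => [<-|_]; rewrite ?mulr1n ?mulr0n.
  by rewrite (malg_sumEw msuppU_le) big_seq_fset1 mcoeffUU.
exists f; split=> // f' [f'C xE']; apply/malgP => g; apply/eqP.
rewrite -subr_eq0; apply/eqP/(p_inj (g := g)).
  by rewrite addrC -scaleN1r CD.
have := congr1 (p g) xE'; rewrite xE !pE // => fg.
by rewrite addrC -scaleN1r p_linear fg scaleN1r addNr.
Qed.

End DirectSum.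

(* The g-component of x. *)
Section Component.
Variables (F : fieldType) (G : groupType) (A : gradedAlgebra F G).

Definition gr_proj (g : G) (x : A) : A := (sval (cid (gr_direct A x)))@_g.

Lemma gr_projP x (f : {malg A[G]}) : (forall g, f@_g \in gr_comp A g) ->
  x = \sum_(g <- msupp f) f@_g -> forall g, gr_proj g x = f@_g.
Proof.
by move=> fC xE g; rewrite /gr_proj; case: cid => /= f' [_ /(_ f)->].
Qed.

Lemma gr_proj_id g h x : x \in gr_comp A h ->
  gr_proj g x = if h == g then x else 0.
Proof.
move=> Cx; rewrite (@gr_projP _ (mkmalgU h x)) => [|k|].
- by rewrite mcoeffU; case: eqP.
- rewrite mcoeffU; case: eqP => [<-|_]; rewrite ?mulr1n ?mulr0n //.
  by case: (gr_submod A k).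
by rewrite (malg_sumEw msuppU_le) big_seq_fset1 mcoeffUU.
Qed.

Lemma gr_proj_linear g : linear (gr_proj g).
Proof.
move=> a x y; have [f [[fC xE] _]] := gr_direct A x.
have [f' [[f'C yE] _]] := gr_direct A y.
rewrite (gr_projP fC xE) (gr_projP f'C yE).
pose d := (msupp f `|` msupp f')%fset.
pose f2 : {malg A[G]} := [malg g in d => a *: f@_g + f'@_g].
have f2E h : f2@_h = a *: f@_h + f'@_h.
  rewrite mcoeffE; case: ifP => //; rewrite inE => /norP[nf nf'].
  by rewrite !mcoeff_outdom // scaler0 addr0.
rewrite -f2E; apply: gr_projP => [h|].
  by rewrite f2E; case: (gr_submod A h) => _ ->.
have le2 : (msupp f2 `<=` d)%fset.
  apply/fsubsetP=> h; rewrite -mcoeff_neq0; apply: contraNT => nd.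
  by rewrite mcoeffE (negPf nd).
rewrite xE yE (malg_sumEw le2) (malg_sumEw (fsubsetUl _ _ : _ `<=` d)%fset).
rewrite (malg_sumEw (fsubsetUr _ _ : _ `<=` d)%fset).
by rewrite scaler_sumr -big_split; apply: eq_bigr => h _; rewrite f2E.
Qed.

End Component.

Lemma lspan_mulr (F : fieldType) (A : algType F) (S1 S2 S3 : A -> Prop) x y :
    (forall x y, S1 x -> S2 y -> x * y \in lspan S3) ->
  x \in lspan S1 -> y \in lspan S2 -> x * y \in lspan S3.
Proof.
move=> SM Sx Sy; have [S0 SD] := lspan_closed S3.
move: x Sx; apply: lspan_ind => [|a x z hx hz|x Sx].
- by rewrite mul0r.
- by rewrite mulrDl -scalerAl; apply: SD.
move: y Sy; apply: lspan_ind => [|a x' z hx hz|x' Sx'].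
- by rewrite mulr0.
- by rewrite mulrDr -scalerAr; apply: SD.
exact: SM.
Qed.

(* The parameter c of the carrier only selects the product. *)
Definition tga (F : fieldType) (Gamma : groupType) (c : cocycle2 F Gamma) :
  Type := {malg F[Gamma]}.
HB.instance Definition _ (F : fieldType) (Gamma : groupType)
  (c : cocycle2 F Gamma) := GRing.Lmodule.on (tga c).

HB.lock Definition tga_u (F : fieldType) (Gamma : groupType)
  (c : cocycle2 F Gamma) (k : Gamma) : tga c := mkmalgU k 1.

(* The bilinear product determined by u_k1 u_k2 = c(k1, k2) u_(k1 k2). *)
HB.lock Definition tga_mul (F : fieldType) (Gamma : groupType)
  (c : cocycle2 F Gamma) (x y : tga c) : tga c :=
  malg_ext (fun k1 =>
    malg_ext (fun k2 => c k1 k2 *: tga_u c (k1 * k2)%g) y) x.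

Section TwistedGroupAlgebra.
Variables (F : fieldType) (Gamma : groupType) (c : cocycle2 F Gamma).
Local Notation tga := (tga c).
Local Notation tga_u := (tga_u c).
Local Notation tga_mul := (@tga_mul F Gamma c).
Implicit Types x y z : tga.

Definition tga_one : tga := (c 1%g 1%g)^-1 *: tga_u 1%g.

Fact tga_mulDl a x y z : tga_mul (a *: x + y) z = a *: tga_mul x z + tga_mul y z.
Proof. by rewrite tga_mul.unlock; exact: malg_ext_linear. Qed.

Fact tga_mulDr a x y z : tga_mul z (a *: x + y) = a *: tga_mul z x + tga_mul z y.
Proof.
rewrite tga_mul.unlock -malg_extP; apply: malg_ext_eq => k.
exact: malg_ext_linear.
Qed.

(* Linear extension along the basis u. *)
Lemma malg_ext_u (V : lmodType F) (f : Gamma -> V) k :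
  malg_ext f (tga_u k) = f k.
Proof. by rewrite tga_u.unlock malg_extU scale1r. Qed.

Lemma tga_lin_eq (V : lmodType F) (f g : tga -> V) : linear f -> linear g ->
  (forall k, f (tga_u k) = g (tga_u k)) -> f =1 g.
Proof. by rewrite tga_u.unlock; apply: malg_lin_eq. Qed.

Lemma tga_sumE x : x = malg_ext tga_u x.
Proof.
by rewrite tga_u.unlock; apply: (malg_linE (g := @id {malg F[Gamma]})).
Qed.

Fact tga_mul_u k1 k2 :
  tga_mul (tga_u k1) (tga_u k2) = c k1 k2 *: tga_u (k1 * k2)%g.
Proof. by rewrite tga_mul.unlock !malg_ext_u. Qed.

Fact tga_mul0l x : tga_mul 0 x = 0.
Proof.
by have := tga_mulDl (-1) 0 0 x; rewrite !scaleN1r oppr0 addr0 addNr.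
Qed.
Fact tga_mul0r x : tga_mul x 0 = 0.
Proof.
by have := tga_mulDr (-1) 0 0 x; rewrite !scaleN1r oppr0 addr0 addNr.
Qed.
Fact tga_mulZl a x y : tga_mul (a *: x) y = a *: tga_mul x y.
Proof. by have := tga_mulDl a x 0 y; rewrite tga_mul0l !addr0. Qed.
Fact tga_mulZr a x y : tga_mul x (a *: y) = a *: tga_mul x y.
Proof. by have := tga_mulDr a y 0 x; rewrite tga_mul0r !addr0. Qed.

Fact tga_mulA : associative tga_mul.
Proof.
move=> x y z; move: x; apply: tga_lin_eq.
- by move=> k u v; rewrite tga_mulDl.
- by move=> k u v; rewrite !tga_mulDl.
move=> k1; move: y; apply: tga_lin_eq.
- by move=> k u v; rewrite tga_mulDl tga_mulDr.
- by move=> k u v; rewrite tga_mulDr tga_mulDl.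
move=> k2; move: z; apply: tga_lin_eq.
- by move=> k u v; rewrite !tga_mulDr.
- by move=> k u v; rewrite tga_mulDr.
move=> k3; rewrite !tga_mul_u tga_mulZl tga_mulZr !tga_mul_u.
by rewrite !scalerA cocP mulgA.
Qed.

Fact tga_mul1 : left_id tga_one tga_mul.
Proof.
apply: tga_lin_eq => [a x y|//|k]; first exact: tga_mulDr.
rewrite tga_mulZl tga_mul_u mul1g coc1l scalerA mulVf ?scale1r //.
exact: coc_neq0.
Qed.

Fact tga_mulr1 : right_id tga_one tga_mul.
Proof.
apply: tga_lin_eq => [a x y|//|k]; first exact: tga_mulDl.
rewrite tga_mulZr tga_mul_u mulg1 coc1r scalerA mulVf ?scale1r //.
exact: coc_neq0.
Qed.

Fact tga_mul_addl : left_distributive tga_mul +%R.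
Proof. by move=> x y z; have := tga_mulDl 1 x y z; rewrite !scale1r. Qed.
Fact tga_mul_addr : right_distributive tga_mul +%R.
Proof. by move=> x y z; have := tga_mulDr 1 y z x; rewrite !scale1r. Qed.

Fact tga_oner_neq0 : tga_one != 0.
Proof.
apply/eqP=> /(congr1 (mcoeff 1%g)); rewrite /tga_one tga_u.unlock.
rewrite mcoeffZ mcoeffUU mcoeff0 mulr1.
by apply/eqP; rewrite invr_eq0 coc_neq0.
Qed.

HB.instance Definition _ := GRing.Zmodule_isNzRing.Build tga
  tga_mulA tga_mul1 tga_mulr1 tga_mul_addl tga_mul_addr tga_oner_neq0.

Fact tga_scalerAl a x y : a *: (x * y) = a *: x * y.
Proof. by rewrite [RHS]tga_mulZl. Qed.
HB.instance Definition _ := GRing.Lmodule_isLalgebra.Build F tga tga_scalerAl.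
Fact tga_scalerAr a x y : a *: (x * y) = x * (a *: y).
Proof. by rewrite [RHS]tga_mulZr. Qed.
HB.instance Definition _ := GRing.Lalgebra_isAlgebra.Build F tga tga_scalerAr.

Lemma tga_uM k1 k2 : tga_u k1 * tga_u k2 = c k1 k2 *: tga_u (k1 * k2)%g.
Proof. exact: tga_mul_u. Qed.

Lemma tga_oneE : 1 = (c 1%g 1%g)^-1 *: tga_u 1%g.
Proof. by []. Qed.

Variables (G : groupType) (p : {multiplicative Gamma -> G}).

Definition tga_comp (g : G) : {pred tga} :=
  lspan (fun x => exists2 k, p k = g & x = tga_u k).

Definition tga_proj (g : G) (x : tga) : tga :=
  malg_ext (fun k => if p k == g then tga_u k else 0) x.

Fact tga_proj_id g h x : x \in tga_comp h ->
  tga_proj g x = if h == g then x else 0.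
Proof.
move: x; apply: lspan_ind => [|a y z hy hz|y [k <- ->]].
- by rewrite /tga_proj raddf0 if_same.
- rewrite /tga_proj malg_ext_linear -!/(tga_proj g _) hy hz.
  by case: ifP => // _; rewrite scaler0 addr0.
by rewrite /tga_proj malg_ext_u.
Qed.

Fact tga_comp_submod g : GRing.submod_closed (tga_comp g).
Proof. exact: lspan_closed. Qed.

Fact tga_comp1 : 1 \in tga_comp 1%g.
Proof.
rewrite tga_oneE; apply: rpredZ; apply: mem_lspan; exists 1%g => //.
by apply: (mulgI (p 1%g)); rewrite -gmulfM !mulg1.
Qed.

Fact tga_compM g h x y :
  x \in tga_comp g -> y \in tga_comp h -> x * y \in tga_comp (g * h)%g.
Proof.
apply: lspan_mulr => u v [k <- ->] [k' <- ->]; rewrite tga_uM.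
by apply: rpredZ; apply: mem_lspan; exists (k * k')%g; rewrite ?gmulfM.
Qed.

Fact tga_direct (x : tga) : exists! f : {malg tga[G]},
  (forall g, f@_g \in tga_comp g) /\ x = \sum_(g <- msupp f) f@_g.
Proof.
apply: (@direct_sum_criterion F tga tga G tga_comp tga_proj).
- exact: tga_comp_submod.
- by move=> g; apply: malg_ext_linear.
- by move=> g h y /tga_proj_id-> /negPf->.
- by move=> g y /tga_proj_id->; rewrite eqxx.
move=> y; rewrite [y]tga_sumE malg_ext.unlock; apply: rpred_sum => k _; apply: rpredZ; apply: mem_lspan.
by exists (p k); apply: mem_lspan; exists k.
Qed.

Definition twisted_group_algebra : gradedAlgebra F G :=
  GradedAlgebra tga_comp_submod tga_comp1 tga_compM tga_direct.

End TwistedGroupAlgebra.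

Section GradedTensor.
Variables (F : fieldType) (G : groupType) (A B : gradedAlgebra F G).

(* The pure tensors spanning A_g (x) B_g. *)
Definition gtens_homog (g : G) (t : tensor_alg A B) : Prop :=
  exists a b, [/\ a \in gr_comp A g, b \in gr_comp B g & t = tens a b].

Definition gtens_pred : {pred tensor_alg A B} :=
  lspan (fun t => exists g, gtens_homog g t).

Fact gtens_mulr g h x y : gtens_homog g x -> gtens_homog h y ->
  gtens_homog (g * h)%g (x * y).
Proof.
move=> [a [b [Aa Bb ->]]] [a' [b' [Aa' Bb' ->]]].
by exists (a * a'), (b * b'); rewrite tensM !gr_mul.
Qed.

Fact gtens_subalg : GRing.subalg_closed gtens_pred.
Proof.
have [S0 SD] := lspan_closed (fun t => exists g, gtens_homog g t).
split=> // [|x y]; last first.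
  apply: lspan_mulr => u v [g hu] [h hv].
  by apply: mem_lspan; exists (g * h)%g; apply: gtens_mulr.
by apply: mem_lspan; exists 1%g, 1, 1; rewrite !gr_one.
Qed.
HB.instance Definition _ := GRing.isSubalgClosed.Build F (tensor_alg A B)
  gtens_pred gtens_subalg.

(* The subalgebra (+)_g (A_g (x) B_g) of A (x) B. *)
Record gtens := GTens { gtens_val : tensor_alg A B; _ : gtens_val \in gtens_pred }.
HB.instance Definition _ := [isSub for gtens_val].
HB.instance Definition _ := [Choice of gtens by <:].
HB.instance Definition _ := [SubChoice_isSubAlgebra of gtens by <:].

Definition gtens_comp (g : G) : {pred gtens} :=
  fun x => val x \in lspan (gtens_homog g).

Fact gtens_comp_submod g : GRing.submod_closed (gtens_comp g).
Proof.
have [S0 SD] := lspan_closed (gtens_homog g).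
split=> [|a x y Cx Cy]; rewrite /gtens_comp !unfold_in.
  by rewrite raddf0.
by rewrite linearP; apply: SD.
Qed.

Fact gtens_comp1 : 1 \in gtens_comp 1%g.
Proof. by apply: mem_lspan; exists 1, 1; rewrite !gr_one. Qed.

Fact gtens_compM g h x y :
  x \in gtens_comp g -> y \in gtens_comp h -> x * y \in gtens_comp (g * h)%g.
Proof.
move=> Cx Cy; rewrite unfold_in /gtens_comp rmorphM.
apply: lspan_mulr Cx Cy => u v hu hv.
by apply: mem_lspan; apply: gtens_mulr.
Qed.

Definition gtens_proj (g : G) (x : gtens) : tensor_alg A B :=
  tensor_lift (fun a b => tens (gr_proj g a) b) (val x).

Fact gtens_proj_bilin g :
  bilin (fun (a : A) (b : B) => tens (gr_proj g a) b).
Proof. by split=> ? ? ? ?; rewrite ?gr_proj_linear (tensDl, tensDr). Qed.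

Fact gtens_proj_id g h x : x \in gtens_comp h ->
  gtens_proj g x = if h == g then val x else 0.
Proof.
rewrite unfold_in /gtens_proj; have lin := tensor_lift_linear (gtens_proj_bilin g).
move: (val x); apply: lspan_ind => [|k y z hy hz|y [a [b [Aa Bb ->]]]].
- by have := lin (-1) 0 0; rewrite !scaleN1r oppr0 addr0 addNr if_same.
- by rewrite lin hy hz; case: ifP => // _; rewrite scaler0 addr0.
rewrite (tensor_lift_tens (gtens_proj_bilin g)) (gr_proj_id g Aa).
case: ifP => // _; have := tensDl (-1) (0 : A) 0 b.
by rewrite !scaleN1r oppr0 addr0 addNr.
Qed.

Fact gtens_direct (x : gtens) : exists! f : {malg gtens[G]},
  (forall g, f@_g \in gtens_comp g) /\ x = \sum_(g <- msupp f) f@_g.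
Proof.
apply: (@direct_sum_criterion F gtens (tensor_alg A B) G gtens_comp gtens_proj).
- exact: gtens_comp_submod.
- move=> g a y z; rewrite /gtens_proj linearP.
  exact: (tensor_lift_linear (gtens_proj_bilin g)).
- by move=> g h y /gtens_proj_id-> /negPf->.
- by move=> g y /gtens_proj_id->; rewrite eqxx => y0; apply: val_inj; rewrite raddf0.
move=> [t t_in]; have [S0 SD] := lspan_closed (fun y => exists g, y \in gtens_comp g).
suff [y yt Sy] : exists2 y : gtens, val y = t &
    y \in lspan (fun y => exists g, y \in gtens_comp g).
  by rewrite (_ : GTens t_in = y) //; apply: val_inj.
move: t t_in; apply: lspan_ind => [|a t t' [y <- Sy] [y' <- Sy']|t [g ht]].
- by exists 0; rewrite ?raddf0.
- by exists (a *: y + y'); [rewrite linearP | apply: SD].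
have t_in : t \in gtens_pred by apply: mem_lspan; exists g.
exists (GTens t_in) => //; apply: mem_lspan; exists g.
by rewrite unfold_in /gtens_comp; apply: mem_lspan.
Qed.

Definition graded_tensor : gradedAlgebra F G :=
  GradedAlgebra gtens_comp_submod gtens_comp1 gtens_compM gtens_direct.

End GradedTensor.

(* alpha(A) = F^alpha G (x)^G A, where F^alpha G is graded by G itself. *)
Definition twisting (F : fieldType) (G : groupType) (alpha : cocycle2 F G)
    (A : gradedAlgebra F G) : gradedAlgebra F G :=
  graded_tensor (twisted_group_algebra alpha idfun) A.

(* Main.v *)
Require Import Defs.
From HB Require Import structures.
From mathcomp Require Import all_boot all_algebra.
From mathcomp Require Import monalg.

(** Write u_k, v_g and w_k for the bases of F^c Gamma, F^alpha G and
    F^(c inf(alpha)) Gamma, and p : Gamma -> G for the projection.  The elements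
    v_(p k) (x) u_k form a basis of the twisting: its g-component is
    F v_g (x) (the span of the u_k with p k = g).  They multiply by
    (v_(p k) (x) u_k) (v_(p k') (x) u_k')
      = alpha(p k, p k') c(k, k') v_(p (k k')) (x) u_(k k'),
    that is, exactly as the w_k do; so w_k |-> v_(p k) (x) u_k is the required
    isomorphism.

    The morphism out of F^(c inf(alpha)) Gamma comes from the universal property
    of a twisted group algebra ([tga_hom_exists]).  It is bijective because the
    linear map v_g (x) u_k |-> w_k if p k = g, and 0 otherwise ([untwist]), inverts
    it.  That map is defined on all of F^alpha G (x) F^c Gamma, where it is not
    multiplicative; on the twisting it is, being there the inverse of an algebra
    morphism ([graded_iso_inverse]). *)

Set Implicit Arguments.
Unset Strict Implicit.
Unset Printing Implicit Defensive.

Import GRing.Theory.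

Local Open Scope ring_scope.

(** The universal property of F^c Gamma.  The product rule alone also holds for
    b = 0, so the unit needs its own condition: the unit of F^c Gamma is
    c(1, 1)^-1 u_1, since cocycles are not assumed to be normalized. *)
Lemma tga_hom_exists (F : fieldType) (Gamma : groupType) (c : cocycle2 F Gamma)
    (B : algType F) (b : Gamma -> B) :
    (forall k k', b k * b k' = c k k' *: b (k * k')%g) ->
    b 1%g = c 1%g 1%g *: 1 ->
  exists f : {lrmorphism tga c -> B}, forall k, f (tga_u c k) = b k.
Proof.
move=> bM b1; pose f : tga c -> B := malg_ext b.
have f_lin : linear f by exact: malg_ext_linear.
have f_u k : f (tga_u c k) = b k by exact: malg_ext_u.
pose f_linM := GRing.isLinear.Build F (tga c) B *:%R f f_lin.
pose f_linear : {linear tga c -> B} := HB.pack f f_linM.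
have fZ a x : f (a *: x) = a *: f x by exact: (linearZ_LR f_linear).
have f_mul : monoid_morphism f.
  split; first rewrite tga_oneE fZ f_u b1 scalerA mulVf ?scale1r //.
    exact: coc_neq0.
  move=> x y; move: x; apply: tga_lin_eq => [a x z|a x z|k].
  - by rewrite mulrDl -scalerAl f_lin.
  - by rewrite f_lin mulrDl -scalerAl.
  move: y; apply: tga_lin_eq => [a x z|a x z|k'].
  - by rewrite mulrDr -scalerAr f_lin.
  - by rewrite f_lin mulrDr -scalerAr.
  by rewrite tga_uM fZ !f_u bM.
pose f_mulM := GRing.isMonoidMorphism.Build (tga c) B f f_mul.
by exists (HB.pack f f_linM f_mulM : {lrmorphism tga c -> B}).
Qed.

(** Lets an isomorphism be constructed in the direction in which the universal
    property gives an algebra morphism: multiplicativity and linearity of the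
    other direction follow. *)
Lemma graded_iso_inverse (F : fieldType) (G : groupType)
    (A B : gradedAlgebra F G) (f : {lrmorphism B -> A}) (h : A -> B) :
    cancel f h -> cancel h f ->
    (forall g y, y \in gr_comp B g -> f y \in gr_comp A g) ->
    (forall g x, x \in gr_comp A g -> h x \in gr_comp B g) ->
  graded_iso A B.
Proof.
move=> fK hK f_comp h_comp.
pose h_linM := GRing.isLinear.Build F A B *:%R h (can2_linear fK hK).
pose h_mulM := GRing.isMonoidMorphism.Build A B h (can2_monoid_morphism fK hK).
exists (HB.pack h h_linM h_mulM : {lrmorphism A -> B}); split.
  by exists f.
by move=> g x; apply/idP/idP=> [/f_comp|/h_comp//]; rewrite hK.
Qed.

Lemma tensZl (F : fieldType) (V W : lmodType F) a (v : V) (w : W) :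
  tens (a *: v) w = a *: tens v w.
Proof. exact: (GRing.scalable_linear ((tens_bilin V W).1 w)). Qed.

Lemma tensZr (F : fieldType) (V W : lmodType F) a (v : V) (w : W) :
  tens v (a *: w) = a *: tens v w.
Proof. exact: (GRing.scalable_linear ((tens_bilin V W).2 v)). Qed.

Section Twisting.
Variables (F : fieldType) (Gamma G : groupType) (p : {multiplicative Gamma -> G}).
Variables (c : cocycle2 F Gamma) (alpha : cocycle2 F G).

Local Notation calpha := (coc_mul c (inflation p alpha)).
Local Notation FalphaG := (twisted_group_algebra alpha idfun).
Local Notation FcGamma := (twisted_group_algebra c p).
Local Notation twist := (gtens FalphaG FcGamma).
Local Notation u := (tga_u c).
Local Notation v := (tga_u alpha).
Local Notation w := (tga_u calpha).

Lemma twist_basis_homog k :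
  gtens_homog (A := FalphaG) (B := FcGamma) (p k) (tens (v (p k)) (u k)).
Proof.
exists (v (p k)), (u k); split=> //; apply: mem_lspan; first by exists (p k).
by exists k.
Qed.

Lemma twist_basis_in k :
  tens (v (p k)) (u k) \in gtens_pred (A := FalphaG) (B := FcGamma).
Proof. by apply: mem_lspan; exists (p k); apply: twist_basis_homog. Qed.

Definition twist_basis k : twist := GTens (twist_basis_in k).

Lemma twist_basisM k k' :
  twist_basis k * twist_basis k' = calpha k k' *: twist_basis (k * k')%g.
Proof.
apply: val_inj; rewrite rmorphM linearZ /= tensM !tga_uM -gmulfM.
by rewrite tensZl tensZr scalerA mulrC.
Qed.

Let p1 : p 1%g = 1%g.
Proof. by apply: (mulgI (p 1%g)); rewrite -gmulfM !mulg1. Qed.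

Lemma twist_basis1 : twist_basis 1%g = calpha 1%g 1%g *: 1.
Proof.
apply: val_inj.
transitivity (calpha 1%g 1%g *: tens (1 : tga alpha) (1 : tga c)); last first.
  by rewrite linearZ.
rewrite !tga_oneE tensZl tensZr !scalerA -[LHS]scale1r /= p1 -mulrA -invfM.
by rewrite mulrA [c _ _ * _]mulrC divff // mulf_neq0 ?coc_neq0.
Qed.

(** The coefficient of a at p k kills every v_g (x) u_k with g != p k, that is,
    the pure tensors of basis vectors that lie outside the twisting. *)
Definition untwist_form (a : tga alpha) (b : tga c) : tga calpha :=
  malg_ext (fun k => a@_(p k) *: w k) b.

Lemma untwist_form_bilin : bilin untwist_form.
Proof.
split=> [b|a]; last exact: malg_ext_linear.
move=> x a a'; rewrite -malg_extP; apply: malg_ext_eq => k.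
by rewrite mcoeffD mcoeffZ scalerDl scalerA.
Qed.

Lemma untwist_form_basis g k :
  untwist_form (v g) (u k) = if p k == g then w k else 0.
Proof.
rewrite /untwist_form malg_ext_u tga_u.unlock mcoeffU eq_sym.
by case: eqP; rewrite (scale1r, scale0r).
Qed.

Definition untwist : tensor FalphaG FcGamma -> tga calpha :=
  tensor_lift untwist_form.

Lemma untwist_linear : linear untwist.
Proof. exact: (tensor_lift_linear untwist_form_bilin). Qed.

Lemma untwist_tens a b : untwist (tens a b) = untwist_form a b.
Proof. exact: (tensor_lift_tens untwist_form_bilin). Qed.

Lemma untwist0 : untwist 0 = 0.
Proof.
by have := untwist_linear (-1) 0 0; rewrite !scaleN1r oppr0 addr0 addNr.
Qed.

Lemma twisting_graded_iso :
  graded_iso (twisting alpha FcGamma) (twisted_group_algebra calpha p).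
Proof.
have [f f_w] := tga_hom_exists twist_basisM twist_basis1.
have valf_linear a x y : val (f (a *: x + y)) = a *: val (f x) + val (f y).
  by rewrite !linearP.
pose recovered t := val (f (untwist t)) = t.
have recovered0 : recovered 0 by rewrite /recovered untwist0 !raddf0.
have recoveredP a s t : recovered s -> recovered t -> recovered (a *: s + t).
  by rewrite /recovered untwist_linear valf_linear => -> ->.
have homogP g t : gtens_homog (A := FalphaG) (B := FcGamma) g t ->
    untwist t \in gr_comp (twisted_group_algebra calpha p) g /\ recovered t.
  have [C0 CP] := gr_submod (twisted_group_algebra calpha p) g.
  (* Both claims are linear in each factor of t, so that t may be taken to be
     v_g (x) u_k with p k = g. *)
  case=> a [b [Aa Bb ->]].
  move: a Aa; apply: lspan_ind => [|x a a' [Ca Ra] [Ca' Ra']|_ [g' /= -> ->]].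
  - by rewrite -(scale0r (0 : tga alpha)) tensZl scale0r untwist0.
  - by rewrite tensDl untwist_linear; split; [exact: CP | exact: recoveredP].
  move: b Bb; apply: lspan_ind => [|x b b' [Cb Rb] [Cb' Rb']|_ [k <- ->]].
  - by rewrite -(scale0r (0 : tga c)) tensZr scale0r untwist0.
  - by rewrite tensDr untwist_linear; split; [exact: CP | exact: recoveredP].
  rewrite /recovered untwist_tens untwist_form_basis eqxx f_w.
  by split=> //; apply: mem_lspan; exists k.
have fK : cancel f (untwist \o val).
  apply: tga_lin_eq => [a x y|//|k] /=; first by rewrite valf_linear untwist_linear.
  by rewrite f_w [LHS]untwist_tens untwist_form_basis eqxx.
apply: (@graded_iso_inverse _ _ (twisting alpha FcGamma)
  (twisted_group_algebra calpha p) f (untwist \o val) fK).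
- case=> t t_in; apply: val_inj; rewrite -/(recovered t).
  move: t t_in; apply: lspan_ind => [//|a s t|t [g /homogP[]]//].
  exact: recoveredP.
- move=> g y Cy; rewrite unfold_in /=.
  have [S0 SP] := lspan_closed (gtens_homog (A := FalphaG) (B := FcGamma) g).
  move: y Cy; apply: lspan_ind => [|a x z fx fz|_ [k <- ->]].
  + by rewrite !raddf0.
  + by rewrite valf_linear; apply: SP.
  + by rewrite f_w; apply: mem_lspan; apply: twist_basis_homog.
- move=> g [t t_in]; rewrite unfold_in /=.
  have [C0 CP] := gr_submod (twisted_group_algebra calpha p) g.
  move: t {t_in}; apply: lspan_ind => [|a s t Cs Ct|t /homogP[]//].
  + by rewrite untwist0.
  + by rewrite untwist_linear; apply: CP.
Qed.

End Twisting.

Theorem corollary4p13 (F : fieldType) (Gamma : groupType)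
    (N : normalSubgroup Gamma) (c : cocycle2 F Gamma)
    (alpha : cocycle2 F (quotient_group N)) :
  graded_iso
    (twisting alpha (twisted_group_algebra c (quotient_map N)))
    (twisted_group_algebra (coc_mul c (inflation (quotient_map N) alpha))
       (quotient_map N)).
Proof. exact: twisting_graded_iso. Qed.
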